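(* For all integers $k\ge 3$, $$\max\left\{2R(k-1),\ \frac{k}{k-2}\bigl(R(k)-2\bigr)\right\}\le \tau^\ast(k)\le k\bigl(2R(k-1)-k+1\bigr).$$
   Context: $\vec{T}_k$ is the transitive tournament on $k$ vertices. $R(m)$ is the smallest integer $N$ such that every tournament on $N$ vertices contains a copy of $\vec{T}_m$. For a tournament $T$, a fractional $\vec{T}_k$-tiling is an assignment of weights in $[0,1]$ to the $k$-vertex subsets of $V(T)$ inducing a copy of $\vec{T}_k$ such that, for each vertex, the sum of weights of subsets containing it is at most $1$; its size is the sum of all weights, and $\nu^\ast_k(T)$ denotes the maximum size. $\tau^\ast(k)$ is the smallest integer $n$ such that every tournament $T$ on $n$ vertices satisfies $\nu^\ast_k(T)=n/k$. *)

(* Defs.v *)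
From HB Require Import structures.
From mathcomp Require Import all_boot all_order all_algebra.
From mathcomp Require Import boolp classical_sets reals.

Set Implicit Arguments.
Unset Strict Implicit.
Unset Printing Implicit Defensive.

Import Order.TTheory GRing.Theory Num.Theory.

Definition tournament (V : finType) (e : rel V) : Prop :=
  (forall x, ~~ e x x) /\ (forall x y, x != y -> e x y (+) e y x).

(* [S] induces a copy of the transitive tournament on [k] vertices, whose
   vertices are the [i : 'I_k] and whose arcs are the pairs [i < j]. *)
Definition induces_TT (V : finType) (e : rel V) (k : nat) (S : {set V}) : bool :=
  [exists f : {ffun 'I_k -> V},
    [&& injectiveb f,
        S == [set f i | i : 'I_k]%SET
      & [forall i : 'I_k, forall j : 'I_k, e (f i) (f j) == (i < j)%N]]].

Definition contains_TT (V : finType) (e : rel V) (k : nat) : Prop :=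
  exists S : {set V}, induces_TT e k S.

(* The smallest element of [P]; the value 0 when [P] is empty is a convention. *)
Definition smallest (P : set nat) : nat :=
  xget 0%N [set n | P n /\ forall m, P m -> (n <= m)%N]%classic.

Definition ramsey (m : nat) : nat :=
  smallest [set N | forall (V : finType) (e : rel V),
    #|V| = N -> tournament e -> contains_TT e m]%classic.

Local Open Scope ring_scope.

(* Only the values of [w] on the sets inducing a copy of the transitive
   tournament are constrained, and only these are summed. *)
Definition fractional_tiling (R : realType) (V : finType) (e : rel V) (k : nat)
    (w : {set V} -> R) : Prop :=
  (forall S : {set V}, induces_TT e k S -> 0 <= w S <= 1) /\
  (forall v : V, \sum_(S : {set V} | induces_TT e k S && (v \in S)) w S <= 1).

Definition tiling_size (R : realType) (V : finType) (e : rel V) (k : nat)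
    (w : {set V} -> R) : R :=
  \sum_(S : {set V} | induces_TT e k S) w S.

(* The maximum is attained, since the tilings form a nonempty compact polytope,
   so the default value 0 of [xget] is never used. *)
Definition nu_star (R : realType) (V : finType) (e : rel V) (k : nat) : R :=
  let sizes : set R :=
    [set tiling_size e k w | w in [set w | fractional_tiling e k w]]%classic in
  xget 0 (sizes `&` ubound sizes)%classic.

(* [n] must be positive: the empty tournament satisfies the equation trivially.
   If no such [n] existed, [tau_star R k] would be 0. *)
Definition tau_star (R : realType) (k : nat) : nat :=
  smallest [set n | (0 < n)%N /\
    forall (V : finType) (e : rel V),
      #|V| = n -> tournament e -> nu_star R e k = n%:R / k%:R]%classic.

(* Main.v *)
Require Import Defs.
From mathcomp Require Import all_boot all_order all_algebra ring lra zify.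
From mathcomp Require Import boolp classical_sets reals.
Import Order.TTheory GRing.Theory Num.Theory.
Local Open Scope ring_scope.

(* Lower bounds.  If A and B are T_{k-1}-free with R(k-1) - 1 vertices and all
   arcs go A -> v -> B -> A, then v lies in no T_k.  If the last vertex of a
   T_k-free tournament on R(k) - 1 vertices is blown up to a set U, then every
   T_k has at least two vertices in U, so that 2 nu* <= |U|.

   Upper bound.  By the Farkas lemma, it suffices that a real weighting y of the
   vertices which is nonnegative on every T_k has nonnegative sum.  Put r =
   R(k-1) and let W consist of 2r vertices of smallest weight, the minimum being
   attained at v.  One of the two neighbourhoods of v in W has at least r
   vertices, so v lies in some T_k inside W, with vertex set S.  As y(S) >= 0,
   the vertices outside W have weight at least -y(v)/(k-1), while the 2r - k
   vertices of W outside S have weight at least y(v); for n = k(2r-k+1) these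
   contributions balance. *)

(** * Least elements of sets of natural numbers *)

Lemma smallest_mem {P : set nat} : (exists n, P n) -> P (Defs.smallest P).
Proof.
move=> [n0 Pn0]; have exP : exists n, `[< P n >] by exists n0; apply/asboolP.
case: (ex_minnP exP) => n /asboolP Pn min_n.
have [] // := @xgetPex _ 0%N [set n | P n /\ forall m, P m -> (n <= m)%N]%classic.
by exists n; split=> // m Pm; apply: min_n; apply/asboolP.
Qed.

Lemma smallest_min {P : set nat} {n} : P n -> (Defs.smallest P <= n)%N.
Proof.
rewrite /Defs.smallest; case: xgetP => [m _ [_ min_m] Pn|//]; exact: min_m.
Qed.

(** * Transitive subtournaments as sequences of vertices *)

Section Tournament.
Context {V : finType} {e : rel V} (tour : tournament e).

Lemma tournament_irr : irreflexive e.
Proof. by move=> x; apply/negbTE; case: tour. Qed.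

Lemma tournament_asym {x y} : e x y -> ~~ e y x.
Proof.
have [->|xy] := eqVneq x y; first by rewrite tournament_irr.
by case: tour => _ /(_ _ _ xy); case: (e x y); case: (e y x).
Qed.

Lemma tournament_total {x y} : x != y -> e x y || e y x.
Proof. by move=> xy; case: tour => _ /(_ _ _ xy); case: (e x y). Qed.

Lemma tournament_anti : antisymmetric e.
Proof. by move=> x y /andP[/tournament_asym/negbTE->]. Qed.

Lemma tournament_trans {s} : pairwise e s -> {in s & &, transitive e}.
Proof. exact/pairwise_trans/tournament_anti. Qed.

(** Sequences replace the indexing function so that a vertex can be added at either end of a copy;
    [pairwise e s] makes [s] duplicate-free because [e] is irreflexive. *)
Lemma induces_TTP {k} {S : {set V}} :
  reflect (exists s, [/\ size s = k, pairwise e s & S = [set x in s]%SET])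
          (induces_TT e k S).
Proof.
apply: (iffP existsP) => [[f /and3P[_ /eqP-> /forallP ef]]|[s [<- es ->]]].
  exists [seq f i | i <- enum 'I_k]; split; first by rewrite size_map size_enum_ord.
    rewrite pairwise_map.
    have: pairwise ltn [seq val i | i <- enum 'I_k].
      by rewrite val_enum_ord -sorted_pairwise ?iota_ltn_sorted //; exact: ltn_trans.
    rewrite pairwise_map; apply: sub_pairwise => i j /= ij.
    by have /forallP/(_ j)/eqP-> := ef i.
  by apply/setP => x; rewrite inE; apply/imsetP/mapP => -[i _ ->]; exists i; rewrite ?mem_enum.
have us := pairwise_uniq tournament_irr es.
exists [ffun i => tnth (in_tuple s) i]; apply/and3P; split.
- by apply/injectiveP => i j; rewrite !ffunE => h; apply: ((tuple_uniqP (in_tuple s)) us).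
- apply/eqP/setP => x; rewrite inE; apply/idP/imsetP => [/(tnthP (in_tuple s))[i ->]|[i _ ->]].
    by exists i; rewrite ?ffunE.
  by rewrite ffunE mem_tnth.
- apply/forallP => i; apply/forallP => j; rewrite !ffunE.
  have x0 := tnth (in_tuple s) i.
  have ltP (a b : 'I_(size s)) : (a < b)%N -> e (tnth (in_tuple s) a) (tnth (in_tuple s) b).
    move=> ab; rewrite !(tnth_nth x0).
    by apply: (pairwiseP _ es) => //; rewrite inE ltn_ord.
  case: (ltngtP i j) => [/ltP->//|/ltP/tournament_asym/negbTE->//|/val_inj->].
  by rewrite tournament_irr.
Qed.

Lemma card_induces_TT {k} {S : {set V}} : induces_TT e k S -> #|S| = k.
Proof.
move=> /induces_TTP[s [<- es ->]]; rewrite cardsE; apply/card_uniqP.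
exact: pairwise_uniq tournament_irr es.
Qed.

Lemma contains_TTP {k} :
  contains_TT e k <-> exists2 s, size s = k & pairwise e s.
Proof.
split=> [[S /induces_TTP[s [? ? _]]]|[s ? ?]]; first by exists s.
by exists [set x in s]%SET; apply/induces_TTP; exists s.
Qed.

Lemma card_nbrs (A : {set V}) x :
  (#|A| <= #|[set y in A | e x y]| + #|[set y in A | e y x]| + 1)%N.
Proof.
have sub : A \subset ([set y in A | e x y] :|: [set y in A | e y x] :|: [set x])%SET.
  apply/fintype.subsetP => y yA; rewrite !inE yA /= eq_sym.
  by have [//|/tournament_total] := eqVneq x y; rewrite ?orbT ?orbF.
apply: leq_trans (subset_leq_card sub) _.
apply: leq_trans (leq_card_setU _ _) _; rewrite cards1 leq_add2r.
exact: leq_card_setU.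
Qed.

(** This makes [ramsey m] a genuine minimum. One neighbourhood of any [x] in [A] has at least
    [2 ^ m] vertices, and [x] is put before or after the sequence found there. *)
Lemma exists_TT_pow2 m (A : {set V}) : (2 ^ m <= #|A|)%N ->
  exists s, [/\ size s = m, pairwise e s & {subset s <= A}].
Proof.
elim: m A => [|m IHm] A; first by move=> _; exists [::].
rewrite expnS => hA.
have /card_gt0P[x xA] : (0 < #|A|)%N by have := expn_gt0 2 m; lia.
have := card_nbrs A x => hc.
have [hl|hl] := leqP (2 ^ m) #|[set y in A | e x y]%SET|.
  have [s [zs es sA]] := IHm _ hl; exists (x :: s); split => /=; first by rewrite zs.
    by rewrite es andbT; apply/allP => y /sA; rewrite inE => /andP[].
  by move=> y; rewrite inE => /predU1P[->//|/sA]; rewrite inE => /andP[].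
have [|s [zs es sA]] := IHm [set y in A | e y x]%SET; first by lia.
exists (rcons s x); split; first by rewrite size_rcons zs.
  by rewrite pairwise_rcons es andbT; apply/allP => y /sA; rewrite inE => /andP[].
by move=> y; rewrite mem_rcons inE => /predU1P[->//|/sA]; rewrite inE => /andP[].
Qed.

End Tournament.

(** * Tournament Ramsey numbers *)

Lemma tournament_relpre {U V : finType} {e : rel V} (g : U -> V) :
  injective g -> tournament e -> tournament (relpre g e).
Proof.
move=> gI [eN eT]; split=> [x|x y xy] /=; first exact: eN.
by apply: eT; rewrite (inj_eq gI).
Qed.

Lemma tournament_ltn n : tournament (fun i j : 'I_n => (i < j)%N).
Proof.
by split=> [x|x y]; rewrite ?ltnn // -val_eqE /=; case: ltngtP.
Qed.

Lemma ramsey_contains {m} {V : finType} {e : rel V} :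
  #|V| = ramsey m -> tournament e -> contains_TT e m.
Proof.
move: V e; apply: (@smallest_mem [set N | forall (V : finType) (e : rel V),
  #|V| = N -> tournament e -> contains_TT e m]%classic).
exists (2 ^ m)%N => V e cV tour; apply/(contains_TTP tour).
have [|s [zs es _]] := exists_TT_pow2 tour m [set: V]%SET; first by rewrite cardsT cV.
by exists s.
Qed.

Lemma TT_free_tournament {m n} : (n < ramsey m)%N ->
  exists (V : finType) (e : rel V), [/\ #|V| = n, tournament e & ~ contains_TT e m].
Proof.
move=> nR; apply: contrapT => no; have := ltnNge n (ramsey m); rewrite nR.
move=> /esym/negP; apply; apply: smallest_min => V e cV tour.
by apply: contrapT => noTT; apply: no; exists V, e.
Qed.

(** This keeps the truncated subtractions in [2 * ramsey m - m] and the like exact. *)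
Lemma ramsey_ge m : (m <= ramsey m)%N.
Proof.
have [||S] := @ramsey_contains m 'I_(ramsey m) (fun i j => (i < j)%N).
- exact: card_ord.
- exact: tournament_ltn.
move=> /(card_induces_TT (tournament_ltn _)) cS; rewrite -{1}cS.
by apply: leq_trans (max_card _) _; rewrite card_ord.
Qed.

(** [ramsey_contains] concerns exactly [ramsey m] vertices, so the arcs are restricted to a list [t]
    of that many vertices of [A]. *)
Lemma ramsey_subset {m} {V : finType} {e : rel V} {A : {set V}} :
  tournament e -> (ramsey m <= #|A|)%N ->
  exists s, [/\ size s = m, pairwise e s & {subset s <= A}].
Proof.
move=> tour /card_geqP[t [ut zt tA]].
have tour' : tournament (relpre val e : rel {x | x \in t}).
  exact: tournament_relpre val_inj tour.
have [|s zs es] := (contains_TTP tour').1 (@ramsey_contains m _ _ _ tour').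
  by rewrite card_sig -zt; apply/card_uniqP.
exists (map val s); split; rewrite ?size_map ?pairwise_map //.
by move=> x /mapP[[y yt] _ ->]; exact: tA.
Qed.

Lemma exists_TT_through {m} {V : finType} {e : rel V} {A : {set V}} {x} :
  tournament e -> x \in A -> (2 * ramsey m <= #|A|)%N ->
  exists S : {set V}, [/\ induces_TT e m.+1 S, x \in S & S \subset A].
Proof.
move=> tour xA hA; have hc := card_nbrs tour A x.
suff [s [zs es xs sA]] : exists s, [/\ size s = m.+1, pairwise e s, x \in s & {subset s <= A}].
  exists [set y in s]%SET; split; rewrite ?inE //.
    by apply/(induces_TTP tour); exists s.
  by apply/fintype.subsetP => y; rewrite inE => /sA.
have [hl|hl] := leqP (ramsey m) #|[set y in A | e x y]%SET|.
  have [s [zs es sA]] := ramsey_subset tour hl.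
  exists (x :: s); split; rewrite /= ?zs ?mem_head //.
    by rewrite es andbT; apply/allP => y /sA; rewrite inE => /andP[].
  by move=> y; rewrite inE => /predU1P[->//|/sA]; rewrite inE => /andP[].
have [|s [zs es sA]] := @ramsey_subset m _ _ [set y in A | e y x]%SET tour; first by lia.
exists (rcons s x); split; rewrite ?size_rcons ?zs ?mem_rcons ?mem_head //.
  by rewrite pairwise_rcons es andbT; apply/allP => y /sA; rewrite inE => /andP[].
by move=> y; rewrite mem_rcons inE => /predU1P[->//|/sA]; rewrite inE => /andP[].
Qed.

(** * The Farkas lemma, by induction on the number of forms *)

Lemma farkas {R : realFieldType} {V I : finType} (s : seq I) (a : I -> V -> R) (b : V -> R) :
  uniq s ->
  (forall y : V -> R, (forall i, i \in s -> 0 <= \sum_v a i v * y v) ->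
    0 <= \sum_v b v * y v) ->
  exists2 l : I -> R, forall i, 0 <= l i & forall v, b v = \sum_(i <- s) l i * a i v.
Proof.
elim: s a b => [|j s IHs] a b /=.
  move=> _ hb; exists (fun=> 0) => // v; rewrite big_nil.
  (* With no forms left, the test vector - [b] shows that the squares of the entries of [b] have sum
     at most 0. *)
  have := hb (fun x => - b x) (fun _ => ltac:(done)).
  under eq_bigr do rewrite mulrN.
  rewrite sumrN oppr_ge0 => le0; apply/eqP.
  have := psumr_eq0P (P := predT) (fun x _ => sqr_ge0 (b x)).
  move=> /(_ _ v isT) h; rewrite -sqrf_eq0 h //.
  apply/eqP; rewrite eq_le sumr_ge0 ?andbT => [|x _]; last exact: sqr_ge0.
  by under eq_bigr do rewrite expr2.
move=> /andP[js us] hb.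
have [hs|] := pselect (forall y : V -> R,
    (forall i, i \in s -> 0 <= \sum_v a i v * y v) -> 0 <= \sum_v b v * y v).
  have [l l0 lb] := IHs a b us hs.
  exists (fun i => if i == j then 0 else l i) => [i|v]; first by case: ifP.
  rewrite big_cons eqxx mul0r add0r lb; apply: eq_big_seq => i si.
  by case: ifP => // /eqP ij; rewrite -ij si in js.
(* Otherwise some [x] violates the implication for [s], hence [a j] is negative
   at [x]; subtracting multiples of [a j] makes all the forms vanish at [x]. *)
move=> /existsNP[x /not_implyP[hx /negP]]; rewrite -ltNge => bx.
set aj := \sum_v a j v * x v.
have aj0 : aj < 0.
  rewrite ltNge; apply/negP => aj0; have := hb x; rewrite leNgt bx => /(_ _)/negP.
  by apply=> // i; rewrite inE => /predU1P[->|/hx].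
pose c (f : V -> R) : R := (\sum_v f v * x v) / aj.
pose red (f : V -> R) v := f v - c f * a j v.
(* Reducing a form amounts to first projecting [y] along [x] onto the kernel of [a j], where the
   condition for [j] holds with equality. *)
have redE f (y : V -> R) : \sum_v red f v * y v =
    \sum_v f v * (y v - (\sum_u a j u * y u) / aj * x v).
  under eq_bigr do rewrite mulrBl -mulrA.
  under [RHS]eq_bigr do rewrite mulrBr mulrCA.
  rewrite !sumrB -!mulr_sumr /c; congr (_ - _); ring.
have [|l l0 lb] := IHs (red \o a) (red b) us.
  move=> y hy; rewrite redE; apply: hb => i; rewrite inE => /predU1P[->|si].
    rewrite -redE /red /c divff ?lt_eqF // sumr_ge0 // => v _.
    by rewrite mul1r subrr mul0r.
  by rewrite -redE; exact: hy.
(* The coefficient of [a j] is nonnegative: [b] and [a j] are negative at [x], so [c b] is positive,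
   while [c (a i)] is at most 0 for [i] in [s]. *)
exists (fun i => if i == j then c b - \sum_(i <- s) l i * c (a i) else l i) => [i|v].
  case: ifP => // _; rewrite subr_ge0; apply: (@le_trans _ _ 0).
    rewrite big_seq sumr_le0 // => k ks; rewrite mulr_ge0_le0 //.
    by rewrite /c mulr_ge0_le0 ?hx // invr_le0 ltW.
  by rewrite /c mulr_le0 ?invr_le0 ?ltW.
rewrite big_cons eqxx.
rewrite [X in _ = _ + X](eq_big_seq (fun i => l i * a i v)); last first.
  by move=> i si /=; case: eqP => // ij; rewrite -ij si in js.
have -> : b v = red b v + c b * a j v by rewrite /red subrK.
rewrite lb /red /=.
under eq_bigr do rewrite mulrBr mulrA.
rewrite sumrB -mulr_suml; ring.
Qed.

(** * Fractional tilings and linear programming duality *)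

Section Tiling.
Context {R : realType} {V : finType} {e : rel V} {k : nat}.

Lemma tiling_size_incidence (w : {set V} -> R) (U : {set V}) :
  \sum_(v in U) \sum_(S : {set V} | induces_TT e k S && (v \in S)) w S =
  \sum_(S : {set V} | induces_TT e k S) #|S :&: U|%:R * w S.
Proof.
rewrite (exchange_big_dep (induces_TT e k)) /=; last by move=> v S _ /andP[].
apply: eq_bigr => S TS; rewrite sumr_const mulr_natl; congr (_ *+ _).
by apply: eq_card => v; rewrite inE TS unfold_in /= andbC.
Qed.

(** Weak duality: for positive [c], the weight 1 / [c] on each vertex of [U] is a fractional cover
    of the copies. *)
Lemma tiling_size_le {w : {set V} -> R} {c : nat} {U : {set V}} :
  fractional_tiling e k w ->
  (forall S : {set V}, induces_TT e k S -> (c <= #|S :&: U|)%N) ->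
  c%:R * tiling_size e k w <= #|U|%:R.
Proof.
move=> [w01 wv] hU; rewrite -sumr_const.
apply: le_trans (ler_sum _ (fun v _ => wv v)); rewrite tiling_size_incidence.
rewrite /tiling_size mulr_sumr; apply: ler_sum => S TS.
by rewrite ler_wpM2r ?ler_nat ?hU //; case/andP: (w01 S TS).
Qed.

(** A nonzero value is not the default of [xget], so no compactness argument is needed. *)
Lemma nu_star_attained : nu_star R e k != 0 ->
  exists2 w : {set V} -> R, fractional_tiling e k w & tiling_size e k w = nu_star R e k.
Proof.
by rewrite /nu_star; case: xgetP => [y _ [[w wT <-] _] _|_ /eqP//]; exists w.
Qed.

Lemma nu_star_perfect {w : {set V} -> R} : tournament e -> (0 < k)%N ->
  (forall S : {set V}, 0 <= w S) ->
  (forall v, \sum_(S : {set V} | induces_TT e k S && (v \in S)) w S = 1) ->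
  nu_star R e k = #|V|%:R / k%:R.
Proof.
move=> tour k0 w0 wv.
have kR : 0 < k%:R :> R by rewrite ltr0n.
have cT S : induces_TT e k S -> #|S :&: [set: V]%SET| = k.
  by move=> TS; rewrite finset.setIT (card_induces_TT tour TS).
have wT : fractional_tiling e k w.
  split=> [S TS|v]; last by rewrite wv.
  (* As [k] is positive, a copy has a vertex, and the weights at that vertex sum to 1. *)
  rewrite w0 /=; have /card_gt0P[v vS] : (0 < #|S|)%N by rewrite (card_induces_TT tour TS).
  by rewrite -(wv v) (bigD1 S) ?TS //= lerDl sumr_ge0.
have sz : tiling_size e k w = #|V|%:R / k%:R.
  apply: (canRL (mulfK (lt0r_neq0 kR))); rewrite mulrC -cardsT -sumr_const.
  under [RHS]eq_bigr => v _ do rewrite -(wv v).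
  rewrite tiling_size_incidence mulr_sumr.
  by apply: eq_bigr => S TS; rewrite cT.
have ub (u : {set V} -> R) : fractional_tiling e k u -> tiling_size e k u <= #|V|%:R / k%:R.
  move=> uT; rewrite ler_pdivlMr // mulrC -cardsT; apply: tiling_size_le => // S TS.
  by rewrite cT.
apply: xget_unique => [|y [[u uT <-] uub]].
  by split=> [|y [u uT <-]]; [exists w | exact: ub].
by apply/eqP; rewrite eq_le ub //= -sz uub //; exists w.
Qed.
End Tiling.

(** * The upper bound *)

Lemma exists_lowest {R : realDomainType} {V : finType} (y : V -> R) {m} : (m <= #|V|)%N ->
  exists W : {set V}, #|W| = m /\ forall x z, x \in W -> z \notin W -> y x <= y z.
Proof.
elim: m => [|m IHm] hm; first by exists finset.set0; split=> [|x z]; rewrite ?cards0 ?inE.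
have [W [cW hW]] := IHm (ltnW hm).
have /card_gt0P[x0] : (0 < #|~: W|)%N by rewrite -(cardsC W) cW in hm; lia.
rewrite inE => x0W; have [x /= xW xmin] := arg_minP (P := fun x => x \notin W) y x0W.
exists (x |: W)%SET; split; first by rewrite cardsU1 xW cW.
move=> u z; rewrite !inE negb_or => /predU1P[->|uW] /andP[_ zW]; first exact: xmin.
exact: hW.
Qed.

Lemma sum_ge0_of_TT {R : realFieldType} {V : finType} {e : rel V} {m : nat} (y : V -> R) :
  let r := ramsey m in
  tournament e -> (2 <= m)%N -> #|V| = (m.+1 * (2 * r - m))%N ->
  (forall S : {set V}, induces_TT e m.+1 S -> 0 <= \sum_(v in S) y v) ->
  0 <= \sum_v y v.
Proof.
move=> r tour m2 cV hy; have mr : (m <= r)%N := ramsey_ge m.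
(* Outside [W] there are exactly [m] vertices for each of the [2 * r - m.+1] vertices of [W] not in
   [S]. *)
have hV : (#|V| = 2 * r + (2 * r - m.+1) * m)%N by rewrite cV; nia.
have [|W [cW hW]] := @exists_lowest R V y (2 * r); first by rewrite hV leq_addr.
have /card_gt0P[x0 x0W] : (0 < #|W|)%N by lia.
have [v /= vW vmin] := arg_minP (P := mem W) y x0W.
have [|S [TS vS SW]] := @exists_TT_through m V e W v tour vW; first by rewrite cW.
have cS := card_induces_TT tour TS; have yS := hy S TS.
have cSv : #|(S :\ v)%SET| = m by have := cardsD1 v S; rewrite vS cS => -[->].
have /card_gt0P[x1 x1S] : (0 < #|(S :\ v)%SET|)%N by lia.
have [x /= xS xmax] := arg_maxP (P := mem (S :\ v)%SET) y x1S.
(* The largest weight [y x] is at least the average over the [m] vertices of [S] other than [v].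
   Since [x] lies in [W], it bounds the weights outside [W] from below. *)
have xm : - y v <= m%:R * y x.
  rewrite (big_setD1 v vS) /= in yS; rewrite lerNl -subr_ge0 opprK.
  apply: le_trans yS _; rewrite lerD2l -cSv mulr_natl -sumr_const.
  exact: ler_sum.
have xW : x \in W by move: (xS : x \in (S :\ v)%SET); rewrite !inE => /andP[_ /(fintype.subsetP SW)].
rewrite (bigID (mem W)) /= (bigID (mem S) (mem W)) /=.
have -> : \sum_(i in W | i \in S) y i = \sum_(i in S) y i.
  by apply: eq_bigl => i; rewrite andbC; case: (boolP (i \in S)) => // /(fintype.subsetP SW).
have hWS : y v *+ (2 * r - m.+1) <= \sum_(i in W | i \notin S) y i.
  have <- : #|(W :\: S)%SET| = (2 * r - m.+1)%N by rewrite cardsDS // cW cS.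
  rewrite -sumr_const big_mkcond [leRHS]big_mkcond; apply: ler_sum => i _.
  by rewrite !inE andbC; case: ifP => // /andP[iW _]; exact: vmin.
have hC : y x *+ ((2 * r - m.+1) * m) <= \sum_(i | i \notin W) y i.
  have <- : #|(~: W)%SET| = ((2 * r - m.+1) * m)%N.
    by apply/eqP; rewrite -(eqn_add2l (2 * r)) -hV -cW cardsC.
  rewrite -sumr_const big_mkcond [leRHS]big_mkcond; apply: ler_sum => i _.
  by rewrite !inE; case: ifP => // iW; exact: hW.
rewrite mulnC mulrnA -[y x *+ m]mulr_natl in hC.
(* Each vertex of [W] not in [S] is grouped with [m] vertices outside [W]; by [xm], every group has
   nonnegative weight. *)
have : 0 <= y v *+ (2 * r - m.+1) + (m%:R * y x) *+ (2 * r - m.+1).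
  by rewrite -mulrnDl mulrn_wge0 // -lerBlDl sub0r.
lra.
Qed.

(** The Farkas multipliers expressing the constant 1 through the incidence vectors of the copies are
    the weights of a perfect tiling. *)
Lemma nu_star_of_card {R : realType} {m : nat} {V : finType} {e : rel V} :
  tournament e -> (2 <= m)%N -> #|V| = (m.+1 * (2 * ramsey m - m))%N ->
  nu_star R e m.+1 = #|V|%:R / m.+1%:R.
Proof.
move=> tour m2 cV.
have [|l l0 lE] := @farkas R V {set V} (enum [pred S | induces_TT e m.+1 S])
  (fun S v => (v \in S)%:R) (fun=> 1) (enum_uniq _).
  move=> y hy; under eq_bigr do rewrite mul1r.
  apply: (sum_ge0_of_TT y tour m2 cV) => S TS.
  have := hy S; rewrite mem_enum inE TS => /(_ isT).
  by rewrite [X in _ -> 0 <= X]big_mkcond /=; under eq_bigr do rewrite mulr_natl mulrb.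
apply: (nu_star_perfect tour (w := l)) => // v.
rewrite [RHS](lE v) big_enum_cond /= big_mkcondr /=; apply: eq_big => S.
  by rewrite ?inE ?andbT.
by case: (v \in S); rewrite ?mulr1 ?mulr0.
Qed.

(** * The lower bounds *)

(** Weak duality for a perfect tiling, the obstruction behind both lower bounds; [0 < #|V|] makes
    [nu_star] nonzero, hence attained. *)
Lemma perfect_tiling_bound {R : realType} {V : finType} {e : rel V} {k c : nat} {U : {set V}} :
  (0 < k)%N -> (0 < #|V|)%N -> nu_star R e k = #|V|%:R / k%:R ->
  (forall S : {set V}, induces_TT e k S -> (c <= #|S :&: U|)%N) ->
  (c * #|V| <= k * #|U|)%N.
Proof.
move=> k0 V0 nuE hU; have kR : 0 < k%:R :> R by rewrite ltr0n.
have [|w wT sz] := @nu_star_attained R V e k.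
  by rewrite nuE mulf_neq0 ?invr_eq0 ?pnatr_eq0 -?lt0n.
have := tiling_size_le wT hU.
by rewrite sz nuE mulrA ler_pdivrMr // -!natrM ler_nat [(#|U| * k)%N]mulnC.
Qed.

Lemma map_preimage {T : eqType} {U : Type} {g : U -> T} {s : seq T} :
  (forall x, x \in s -> exists y, x = g y) -> exists t, s = map g t.
Proof.
elim: s => [|x s IHs] hs; first by exists [::].
have [y ->] := hs x (mem_head _ _).
by have [z zs|t ->] := IHs; [apply: hs; rewrite inE zs orbT | exists (y :: t)].
Qed.

(** [None] is the vertex v of the first construction. *)
Definition cyclic_join {A B : finType} (eA : rel A) (eB : rel B) : rel (option (A + B)) :=
  fun x y => match x, y with
  | Some (inl a), Some (inl a') => eA a a'
  | Some (inr b), Some (inr b') => eB b b'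
  | Some (inl _), None | None, Some (inr _) | Some (inr _), Some (inl _) => true
  | _, _ => false
  end.

Lemma tournament_cyclic_join {A B : finType} {eA : rel A} {eB : rel B} :
  tournament eA -> tournament eB -> tournament (cyclic_join eA eB).
Proof.
move=> [irrA totA] [irrB totB].
by split=> [[[a|b]|]|[[a|b]|] [[a'|b']|]] //=; [exact: totA | exact: totB].
Qed.

(** A vertex of [A], [None] and a vertex of [B] form a cyclic triangle, so the other [m] vertices of
    a copy through [None] would all lie in [A] or all in [B]. *)
Lemma cyclic_join_TT_free {A B : finType} {eA : rel A} {eB : rel B} {m S} :
  tournament eA -> tournament eB -> ~ contains_TT eA m -> ~ contains_TT eB m ->
  induces_TT (cyclic_join eA eB) m.+1 S -> None \notin S.
Proof.
move=> tA tB nA nB; have tour := tournament_cyclic_join tA tB.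
move=> /(induces_TTP tour)[s [zs es ->]]; rewrite inE; apply/negP => Ns.
have us := pairwise_uniq (tournament_irr tour) es.
pose t := rem None s.
have zt : size t = m by rewrite size_rem // zs.
have et : pairwise (cyclic_join eA eB) t by apply: subseq_pairwise (rem_subseq _ _) es.
have tE x : x \in t -> x \in s /\ x != None.
  by rewrite mem_rem_uniq // inE => /andP[].
have [/hasP[[[a|b]|] //= at_ _]|/hasPn noA] :=
    boolP (has (fun x => if x is Some (inl _) then true else false) t).
  apply: nA; have [[[a'|b]|] xt|u tu] := @map_preimage _ _ (fun a => Some (inl a)) t.
  - by exists a'.
  - have := @tournament_trans _ _ tour _ es (Some (inl a)) (Some (inr b)) None.
    by move=> /(_ (tE _ at_).1 (tE _ xt).1 Ns isT isT).
  - by have [] := tE _ xt.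
  apply/(contains_TTP tA); exists u; first by rewrite -zt tu size_map.
  by move: et; rewrite tu pairwise_map.
apply: nB; have [[[a|b]|] xt|u tu] := @map_preimage _ _ (fun b => Some (inr b)) t.
- by have := noA _ xt.
- by exists b.
- by have [] := tE _ xt.
apply/(contains_TTP tB); exists u; first by rewrite -zt tu size_map.
by move: et; rewrite tu pairwise_map.
Qed.

(** Since [tau_star] is a least element, every positive [n] below the bound needs its own
    counterexample. *)
Lemma imperfect_lt_2ramsey (R : realType) {m n} : (0 < n)%N -> (n < 2 * ramsey m)%N ->
  exists (V : finType) (e : rel V),
    [/\ #|V| = n, tournament e & nu_star R e m.+1 <> n%:R / m.+1%:R].
Proof.
(* The [n.-1] vertices other than [None] split into two parts of at most [(ramsey m).-1] vertices
   each. *)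
move=> n0 nr; pose a := minn n.-1 (ramsey m).-1.
have [|A [eA [cA tA nA]]] := @TT_free_tournament m a; first by lia.
have [|B [eB [cB tB nB]]] := @TT_free_tournament m (n.-1 - a); first by lia.
have cV : #|{: option (A + B)}| = n by rewrite card_option card_sum cA cB; lia.
exists (option (A + B))%type, (cyclic_join eA eB); split => //.
  exact: tournament_cyclic_join.
rewrite -cV => nuE.
have := perfect_tiling_bound (U := [set~ None]) (ltn0Sn m) _ nuE.
rewrite cV => /(_ m.+1 n0); rewrite cardsC1 cV leq_pmul2l // => h.
suff : (n <= n.-1)%N by lia.
apply: h => S TS.
have NS := cyclic_join_TT_free tA tB nA nB TS.
rewrite (finset.setIidPl _) ?(card_induces_TT (tournament_cyclic_join tA tB) TS) //.
by apply/fintype.subsetP => x xS; rewrite !inE; apply: contraNneq NS => <-.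
Qed.

Lemma card_ord_geq n c : #|[set i : 'I_n | (c <= i)%N]| = (n - c)%N.
Proof.
rewrite -sum1_card (eq_bigl (fun i : 'I_n => (c <= i)%N)); last by move=> i; rewrite inE.
rewrite -(big_mkord (fun i => (c <= i)%N) (fun=> 1%N)).
by rewrite -(big_nat_widenl _ _ _ predT) // sum_nat_const_nat muln1.
Qed.

Lemma imperfect_blowup (R : realType) {k n} :
  (0 < k)%N -> (0 < n)%N -> (2 < ramsey k)%N -> (k * (n - (ramsey k - 2)) < 2 * n)%N ->
  exists (V : finType) (e : rel V),
    [/\ #|V| = n, tournament e & nu_star R e k <> n%:R / k%:R].
Proof.
(* [A] will have [ramsey k - 1] vertices, so that [c] is the index of the last one. *)
move=> k0 n0 r2 hn; set c := (ramsey k - 2)%N in hn.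
have [|A [eA [cA tA nA]]] := @TT_free_tournament k c.+1; first by lia.
have /card_gt0P[a0 _] : (0 < #|A|)%N by rewrite cA.
(* The tournament on [A] with its last vertex blown up to [n - c] vertices
   (if [n <= c], the restriction to its first [n] vertices). *)
pose phi (i : 'I_n) := nth a0 (enum A) (minn i c).
pose e (i j : 'I_n) := if phi i == phi j then (i < j)%N else eA (phi i) (phi j).
have phiE i j : (phi i == phi j) = (minn i c == minn j c).
  by rewrite nth_uniq ?enum_uniq // -cardE cA; lia.
have tour : tournament e.
  split=> [i|i j ij]; first by rewrite /e eqxx ltnn.
  rewrite /e [phi j == _]eq_sym; case: ifP => [_|/negbT phij].
    by case: (tournament_ltn n) => _; apply.
  by case: tA => _; apply.
exists 'I_n, e; split=> //; first exact: card_ord.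
move=> nuE; have := perfect_tiling_bound (e := e) (U := [set i : 'I_n | (c <= i)%N]) k0.
move=> /(_ R 2); rewrite card_ord card_ord_geq => /(_ n0 nuE) h.
suff : (2 * n <= k * (n - c))%N by lia.
(* If at most one vertex of the copy lies in the blown-up set, [phi] embeds the copy into [A]. *)
apply: h => S TS; rewrite ltnNge; apply/negP => /card_le1_eqP S1.
have /(induces_TTP tour)[s [zs es sE]] := TS.
apply: nA; apply/(contains_TTP tA); exists (map phi s); rewrite ?size_map //.
rewrite pairwise_map; apply: (sub_in_pairwise (P := mem s) _ _ es); last exact/allP.
move=> i j si sj; rewrite /= /e phiE; case: ifP => // /eqP mij ij.
suff E : i = j by move: ij; rewrite E ltnn.
have [ic|ic] := ltnP i c; first by apply: val_inj => /=; lia.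
by apply: S1; rewrite !inE sE ?inE; apply/andP; split=> //; lia.
Qed.

Theorem theorem3p3 (R : realType) (k : nat) (hk : (3 <= k)%N) :
  Num.max (2 * (ramsey k.-1)%:R)
          (k%:R / (k%:R - 2) * ((ramsey k)%:R - 2))
    <= (tau_star R k)%:R :> R /\
  (tau_star R k)%:R <= k%:R * (2 * (ramsey k.-1)%:R - k%:R + 1) :> R.
Proof.
case: k hk => // m; rewrite ltnS /= => m2; have mr := ramsey_ge m.
pose perfect := [set n | (0 < n)%N /\ forall (V : finType) (e : rel V),
  #|V| = n -> tournament e -> nu_star R e m.+1 = n%:R / m.+1%:R]%classic.
have perfN : perfect (m.+1 * (2 * ramsey m - m))%N.
  split=> [|V e cV tour]; first by rewrite muln_gt0 /=; lia.
  by rewrite -cV; exact: nu_star_of_card.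
have [tau0 tauP] : perfect (tau_star R m.+1).
  by apply: smallest_mem; exists (m.+1 * (2 * ramsey m - m))%N.
split; last first.
  have := smallest_min perfN; rewrite -/(tau_star R m.+1) -(ler_nat R).
  rewrite natrM natrB ?natrM; last by lia.
  by congr (_ <= _); rewrite -addn1 natrD; ring.
rewrite ge_max; apply/andP; split.
  rewrite -natrM ler_nat leqNgt; apply/negP => /(imperfect_lt_2ramsey R tau0).
  by move=> [V [e [cV tour]]]; apply; exact: tauP.
have k2 : 0 < m.+1%:R - 2 :> R by rewrite subr_gt0 ltr_nat ltnS.
rewrite mulrAC ler_pdivrMr //.
(* In the first case the bound is at most 0; otherwise the blow-up applies. *)
have [r2|r2] := leqP (ramsey m.+1) 2.
  apply: (@le_trans _ _ 0); last by rewrite mulr_ge0 // ltW.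
  by rewrite mulr_ge0_le0 // subr_le0 (ler_nat _ _ 2).
have : (2 * tau_star R m.+1 <= m.+1 * (tau_star R m.+1 - (ramsey m.+1 - 2)))%N.
  rewrite leqNgt; apply/negP => /(imperfect_blowup R (ltn0Sn m) tau0 r2).
  by move=> [V [e [cV tour]]]; apply; exact: tauP.
(* Were the truncated difference in [h] zero, [h] would contradict [tau0]; hence it is a true
   difference. *)
move=> h; have rt : (ramsey m.+1 - 2 <= tau_star R m.+1)%N by nia.
by move: h; rewrite -(ler_nat R) !natrM !natrB ?(ltnW r2) //; lra.
Qed.
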